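(* Let $k$ be a field of characteristic zero, and let $m_1,m_2$ be positive integers such that $m_2$ does not divide $m_1$. Let $d=y^{m_1}\partial_x+(1+y^{m_2}x)\partial_y$, a $k$-derivation of the polynomial ring $R=k[x,y]$. Let $f\in R$ be such that $d(f)=g(x)$, where $g(x)\in k[x]$. Then $f\in k$ and $g(x)=0$.
   Context: Here $d$ is the $k$-derivation of $k[x,y]$ (a $k$-linear map satisfying the Leibniz rule) determined by $d(x)=y^{m_1}$ and $d(y)=1+y^{m_2}x$. *)

(* Defs.v *)
From HB Require Import structures.
From mathcomp Require Import all_boot all_order all_algebra.
From mathcomp Require Import mpoly ring.

Set Implicit Arguments.
Unset Strict Implicit.
Unset Printing Implicit Defensive.

Import GRing.Theory.
Local Open Scope ring_scope.

Section Derivation.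

Variable k : fieldType.

Definition varx : {mpoly k[2]} := 'X_(0 : 'I_2).
Definition vary : {mpoly k[2]} := 'X_(1 : 'I_2).

Definition inx (g : {poly k}) : {mpoly k[2]} := horner_alg varx g.

Definition der (m1 m2 : nat) (f : {mpoly k[2]}) : {mpoly k[2]} :=
  vary ^+ m1 * f^`M(0) + (1 + vary ^+ m2 * varx) * f^`M(1).

(* [der m1 m2] is the k-linear map satisfying the Leibniz rule that is
   determined by its values on x and y. *)
Fact der_is_linear m1 m2 : linear (der m1 m2).
Proof.
move=> c p q; rewrite /der !mderivD !mderivZ !mulrDr -!scalerAr.
by rewrite scalerDr addrACA.
Qed.

HB.instance Definition _ m1 m2 :=
  GRing.isLinear.Build k {mpoly k[2]} {mpoly k[2]} _ (der m1 m2)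
    (der_is_linear m1 m2).

Fact derM m1 m2 p q : der m1 m2 (p * q) = der m1 m2 p * q + p * der m1 m2 q.
Proof. by rewrite /der !mderivM; ring. Qed.

Fact mderiv_var (i j : 'I_2) : ('X_i : {mpoly k[2]})^`M(j) = (i == j)%:R.
Proof.
rewrite mderivX mnm1E; case: eqVneq => [->|_]; last by rewrite scale0r.
by rewrite scale1r -{1}[U_(j)%MM]add0m addmK mpolyX0.
Qed.

Fact der_varx m1 m2 : der m1 m2 varx = vary ^+ m1.
Proof. by rewrite /der !mderiv_var mulr1 mulr0 addr0. Qed.

Fact der_vary m1 m2 : der m1 m2 vary = 1 + vary ^+ m2 * varx.
Proof. by rewrite /der !mderiv_var mulr1 mulr0 add0r. Qed.

End Derivation.

(* Main.v *)
Require Import Defs.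
From mathcomp Require Import all_boot all_order all_algebra.
From mathcomp Require Import mpoly zify.

(* Write c i s for the coefficient of x^s y^i in f. The equation d(f) = g(x)
   says that c 1 is g and that i c(i, s) is determined by c(i - m2, s - 1) and
   c(i - m1 - 1, s + 1), so f is determined by its coefficients c 0 and c 1.
   Let D be the larger of their degrees. The linear form m2 s - i takes the
   same value at (i - m2, s - 1) as at (i, s), and a value larger by
   m1 + m2 + 1 at (i - m1 - 1, s + 1); hence c vanishes where
   m2 s - i >= m2 D, except at (i, s) = (0, D). Consequently
   - if c 1 has degree D, then c(1 + q m2, D + q) <> 0 for all q;
   - if c 0 has degree D > 0, then c(m1 + 1 + q m2, D - 1 + q) <> 0 for all q;
     here m2 not dividing m1 excludes a contribution of c 1.
   Both are absurd for a polynomial f, so c 1 = 0 and c 0 is constant, and then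
   all the other coefficients vanish. *)

Set Implicit Arguments.
Unset Strict Implicit.
Unset Printing Implicit Defensive.

Import GRing.Theory.
Local Open Scope ring_scope.

(** * Vanishing and non-vanishing along the recurrence *)

Section Recurrence.

Variables (k : fieldType) (m1 m2 : nat) (c : nat -> nat -> k).
Hypothesis pchar0 : [pchar k] =i pred0.
Hypothesis m2_gt0 : (0 < m2)%N.
Hypothesis rec : forall i s, (1 < i)%N ->
  c i s *+ i = - (if (0 < s)%N then c (i - m2) s.-1 *+ (i - m2) else 0)
               - (if (m1 < i)%N then c (i - m1.+1) s.+1 *+ s.+1 else 0).

Lemma mulrn_pchar0 (a : k) n : (0 < n)%N -> (a *+ n == 0) = (a == 0).
Proof.
move=> n_gt0; rewrite -mulr_natr mulf_eq0 ((pcharf0P k).1 pchar0).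
by rewrite eqn0Ngt n_gt0 orbF.
Qed.

Lemma coef_eq0 i s : (1 < i)%N ->
  ((0 < s)%N -> (m2 < i)%N -> c (i - m2) s.-1 = 0) ->
  ((m1 < i)%N -> c (i - m1.+1) s.+1 = 0) -> c i s = 0.
Proof.
move=> i_gt1 H1 H2; apply/eqP; rewrite -(@mulrn_pchar0 _ i) ?(ltnW i_gt1) //.
rewrite rec //; case: ifP => [/H1 {}H1|_]; last first.
  by case: ifP => [/H2->|_]; rewrite ?mul0rn oppr0 addr0.
(* For [i <= m2] the truncated multiplier [i - m2] is 0, so row 0 never contributes through this
   term. *)
have ->: c (i - m2) s.-1 *+ (i - m2) = 0.
  by case: (ltnP m2 i) => [/H1->|]; rewrite ?mul0rn // -subn_eq0 => /eqP->.
by case: ifP => [/H2->|_]; rewrite ?mul0rn oppr0 addr0.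
Qed.

Lemma coef_neq0 i s : (1 < i)%N -> (0 < s)%N -> (m2 < i)%N ->
  c (i - m2) s.-1 != 0 -> ((m1 < i)%N -> c (i - m1.+1) s.+1 = 0) -> c i s != 0.
Proof.
move=> i_gt1 s_gt0 m2_lt_i H1 H2.
rewrite -(@mulrn_pchar0 _ i) ?(ltnW i_gt1) // rec // s_gt0.
have ->: (if (m1 < i)%N then c (i - m1.+1) s.+1 *+ s.+1 else 0) = 0.
  by case: ifP => // /H2->; rewrite mul0rn.
by rewrite subr0 oppr_eq0 mulrn_pchar0 // subn_gt0.
Qed.

Section Bounded.

Variable D : nat.
Hypothesis c0_eq0 : forall s, (D < s)%N -> c 0 s = 0.
Hypothesis c1_eq0 : forall s, (D < s)%N -> c 1 s = 0.

(** By strong induction on [i]. The exceptional point [(0, D)] never contributes: the first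
    predecessor has row [i - m2 > 0], the second has column [s + 1 > D]. *)
Lemma coef_above_eq0 i s :
  (m2 * D + i <= m2 * s)%N -> (i != 0) || (s != D) -> c i s = 0.
Proof.
elim/ltn_ind: i s => -[|[|i]] IH s le_s neq.
- have D_le_s : (D <= s)%N by rewrite -(leq_pmul2l m2_gt0); lia.
  by apply: c0_eq0; rewrite ltn_neqAle D_le_s eq_sym andbT.
- by apply: c1_eq0; rewrite -(ltn_pmul2l m2_gt0); lia.
apply: coef_eq0 => // [s_gt0 m2_lt|m1_lt].
- apply: IH; first lia; first last.
    by rewrite subn_eq0 -ltnNge m2_lt.
  by case: s s_gt0 le_s {neq} => // s _; rewrite mulnS /=; lia.
- have D_lt_s : (D < s)%N by rewrite -(ltn_pmul2l m2_gt0); lia.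
  apply: IH; first lia; first by rewrite mulnS; lia.
  by rewrite orbC gtn_eqF // ltnS ltnW.
Qed.

Lemma coef_neq0_of_c1 q : c 1 D != 0 -> c (1 + m2 * q) (D + q) != 0.
Proof.
move=> c1D; elim: q => [|q IH]; first by rewrite muln0 !addn0.
apply: coef_neq0; rewrite ?mulnS; try lia.
  by rewrite addnCA addKn addnS.
by move=> m1_lt; apply: coef_above_eq0; rewrite ?mulnS ?mulnDr; lia.
Qed.

Hypothesis m2_ndvd_m1 : ~~ (m2 %| m1)%N.

(** In rows [i <= m1] only the term from row [i - m2] is present, and it preserves [i - 1] modulo
    [m2]. A row not congruent to 1 thus descends to some row [1 < i <= m2], where no term is
    left. *)
Lemma coef_low_eq0 i s : (0 < i <= m1)%N -> ~~ (m2 %| i.-1)%N -> c i s = 0.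
Proof.
elim/ltn_ind: i s => -[|[|i]] IH s // i_le ndvd; first by rewrite dvdn0 in ndvd.
apply: coef_eq0 => //; last by lia.
move=> s_gt0 m2_lt; apply: IH; try lia.
rewrite /= in ndvd; rewrite subSn // -(@dvdn_addl m2 m2) //=.
by rewrite subnK.
Qed.

Lemma coef_neq0_of_c0 q :
  (0 < D)%N -> c 0 D != 0 -> c (m1.+1 + m2 * q) (D.-1 + q) != 0.
Proof.
move=> D_gt0 c0D; elim: q => [|q IH].
  have m1_gt0 : (0 < m1)%N by case: (m1) m2_ndvd_m1 => //; rewrite dvdn0.
  rewrite muln0 !addn0 -(@mulrn_pchar0 _ m1.+1) // rec //.
  rewrite ltnSn subnn prednK //.
  (* Row [m1 + 1] receives [c 0 D *+ D]; the other term has multiplier 0 if [m2 > m1], and otherwise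
     falls under [coef_low_eq0] because [m2] does not divide [m1 - m2]. *)
  have ->: (if (0 < D.-1)%N then c (m1.+1 - m2) D.-2 *+ (m1.+1 - m2) else 0) = 0.
    case: ifP => // _; case: (leqP m2 m1) => [m2_le|m1_lt]; last first.
      by have/eqP->: (m1.+1 - m2 == 0)%N by rewrite subn_eq0.
    rewrite coef_low_eq0 ?mul0rn //; first by lia.
    by rewrite subSn //= -(@dvdn_addl m2 m2) // subnK.
  by rewrite oppr0 sub0r oppr_eq0 mulrn_pchar0.
apply: coef_neq0; rewrite ?mulnS; try lia.
  by rewrite addnCA addKn addnS.
(* The other predecessor has row [m2 * (q + 1)] and column [D + q + 1]: it lies exactly on the
   boundary [m2 s - i = m2 D] of the vanishing region. *)
by move=> _; apply: coef_above_eq0; case: (D) D_gt0 => // d _;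
  rewrite /= ?mulnS ?mulnDr ?mulnS; lia.
Qed.

End Bounded.

(** The point [(0, 0)] never contributes: the first predecessor has a positive row, the second a
    positive column. *)
Lemma coef_constant i s :
  (forall s, c 1 s = 0) -> (forall s, (0 < s)%N -> c 0 s = 0) ->
  (i != 0) || (s != 0) -> c i s = 0.
Proof.
move=> c1 c0; elim/ltn_ind: i s => -[|[|i]] IH s neq //.
  by apply: c0; rewrite lt0n.
apply: coef_eq0 => // [s_gt0 m2_lt|m1_lt]; apply: IH; rewrite ?orbT //; try lia.
Qed.

End Recurrence.

(** * Exponent vectors in two variables *)

Definition mon2 (s i : nat) : 'X_{1..2} := (U_(ord0) *+ s + U_(ord_max) *+ i)%MM.

Lemma mon2E s i j : mon2 s i j = if j == ord0 then s else i.
Proof.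
rewrite /mon2 mnmDE !mulmnE !mnm1E.
case: j => -[|[|[]]] //= lt_j; first by rewrite mul1n mul0n addn0.
by rewrite mul0n mul1n.
Qed.

Lemma mon2_eta (m : 'X_{1..2}) : m = mon2 (m ord0) (m ord_max).
Proof.
apply/mnmP=> j; rewrite mon2E; case: eqP => [->//|].
case: j => -[|[|[]]] // lt_j neq; first by case: neq; apply: val_inj.
by congr (m _); apply: val_inj.
Qed.

Lemma mon2_U0 : mon2 1 0 = U_(0%R)%MM.
Proof. by rewrite /mon2 mulm1n mulm0n addm0; congr mnm1; apply: val_inj. Qed.

Lemma mon2_U1 : mon2 0 1 = U_(1%R)%MM.
Proof. by rewrite /mon2 mulm1n mulm0n add0m; congr mnm1; apply: val_inj. Qed.

Lemma mon2_le s i s' i' : (mon2 s i <= mon2 s' i')%MM = (s <= s')%N && (i <= i')%N.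
Proof.
apply/mnm_lepP/andP=> [H|[Hs Hi] j]; last by rewrite !mon2E; case: ifP.
by have := H ord0; have := H ord_max; rewrite !mon2E.
Qed.

Lemma mon2B s i s' i' : (mon2 s i - mon2 s' i')%MM = mon2 (s - s') (i - i').
Proof. by apply/mnmP=> j; rewrite mnmBE !mon2E; case: ifP. Qed.

Lemma mon2D s i s' i' : (mon2 s i + mon2 s' i')%MM = mon2 (s + s') (i + i').
Proof. by apply/mnmP=> j; rewrite mnmDE !mon2E; case: ifP. Qed.

Lemma mdeg_mon2 s i : mdeg (mon2 s i) = (s + i)%N.
Proof. by rewrite mdegD !mdegMn !mdeg1 !mul1n. Qed.

Lemma mcoeffMX_if n (R : nzRingType) (p : {mpoly R[n]}) (m u : 'X_{1..n}) :
  (p * 'X_[m])@_u = if (m <= u)%MM then p@_(u - m) else 0.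
Proof.
case: ifP => [le_mu|nle_mu]; first by rewrite -{1}(submK le_mu) addmC mcoeffMX.
apply/memN_msupp_eq0; rewrite (perm_mem (msuppMX _ _)).
by apply/mapP=> -[v _ def_u]; rewrite def_u lem_addr in nle_mu.
Qed.

(** * Coefficients of the derivation *)

Section Coefficients.

Variable k : fieldType.

Lemma mon2_mpolyX s i : varx k ^+ s * vary k ^+ i = 'X_[mon2 s i].
Proof.
rewrite /varx /vary !mpolyXn -mpolyXD.
by congr (mpolyX _ (U_(_) *+ _ + U_(_) *+ _)); apply: val_inj.
Qed.

Lemma mcoeff_inx (g : {poly k}) s i :
  (inx g)@_(mon2 s i) = if i == 0%N then g`_s else 0.
Proof.
elim/poly_ind: g s => [|g c IH] s; first by rewrite /inx raddf0 mcoeff0 coef0 if_same.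
have ->: inx (g * 'X + c%:P) = inx g * 'X_[mon2 1 0] + c%:MP.
  rewrite -mon2_mpolyX expr1 expr0 mulr1 /inx rmorphD rmorphM /=.
  by rewrite horner_algX horner_algC alg_mpolyC.
rewrite mcoeffD mcoeffMX_if mon2_le mon2B subn0 IH mcoeffC coefD coefMX coefC.
rewrite -mdeg_eq0 mdeg_mon2 addn_eq0 andbT lt0n.
by case: s => [|s]; case: i {IH} => [|i] /=; rewrite ?subn1 ?mulr1 ?mulr0 ?addr0.
Qed.

(** In the last term the truncated multiplier [i.+1 - m2] vanishes exactly when [i < m2], and so
    replaces the guard [m2 <= i]. *)
Lemma mcoeff_der m1 m2 (f : {mpoly k[2]}) s i :
  (der m1 m2 f)@_(mon2 s i) =
    (if (m1 <= i)%N then f@_(mon2 s.+1 (i - m1)) *+ s.+1 else 0)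
  + f@_(mon2 s i.+1) *+ i.+1
  + (if (0 < s)%N then f@_(mon2 s.-1 (i.+1 - m2)) *+ (i.+1 - m2) else 0).
Proof.
have dx u v : (f^`M(0))@_(mon2 u v) = f@_(mon2 u.+1 v) *+ u.+1.
  by rewrite mcoeff_deriv mon2E -mon2_U0 mon2D addn1 addn0.
have dy u v : (f^`M(1))@_(mon2 u v) = f@_(mon2 u v.+1) *+ v.+1.
  by rewrite mcoeff_deriv mon2E -mon2_U1 mon2D addn1 addn0.
rewrite /der mulrDl mul1r addrA !mcoeffD.
have ->: vary k ^+ m1 = 'X_[mon2 0 m1] by rewrite -mon2_mpolyX expr0 mul1r.
have ->: vary k ^+ m2 * varx k = 'X_[mon2 1 m2] by rewrite -mon2_mpolyX expr1 mulrC.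
rewrite ![_ * f^`M(_)]mulrC !mcoeffMX_if !mon2_le !mon2B subn0 /= dx dy.
congr (_ + _); rewrite dy subn1; case: (0 < s)%N => //=.
case: leqP => [le_m2|lt_m2]; first by rewrite subSn.
by have/eqP->: (i.+1 - m2 == 0)%N by rewrite subn_eq0.
Qed.

(** Compare coefficients at [y^0]: [m1 > 0] removes the first term of [mcoeff_der], and [1 - m2 = 0]
    the last. *)
Lemma der_eq_inx_coef0 m1 m2 (f : {mpoly k[2]}) g s :
  (0 < m1)%N -> (0 < m2)%N -> der m1 m2 f = inx g -> f@_(mon2 s 1) = g`_s.
Proof.
move=> m1_gt0 m2_gt0 /(congr1 (mcoeff (mon2 s 0))).
rewrite mcoeff_der mcoeff_inx leqNgt m1_gt0 add0r eqxx => <-.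
have/eqP->: (1 - m2 == 0)%N by rewrite subn_eq0.
by rewrite mulr0n if_same addr0.
Qed.

(** Compare coefficients at [y^(i-1)], where [inx g] has none since [i > 1]. *)
Lemma der_eq_inx_rec m1 m2 (f : {mpoly k[2]}) g s i : der m1 m2 f = inx g -> (1 < i)%N ->
  f@_(mon2 s i) *+ i =
    - (if (0 < s)%N then f@_(mon2 s.-1 (i - m2)) *+ (i - m2) else 0)
    - (if (m1 < i)%N then f@_(mon2 s.+1 (i - m1.+1)) *+ s.+1 else 0).
Proof.
case: i => [|[|i]] // /(congr1 (mcoeff (mon2 s i.+1))) + _.
rewrite mcoeff_der mcoeff_inx /= ltnS subSS => eq0.
apply/eqP; rewrite -opprD -addr_eq0 -{}[X in _ == X]eq0.
by rewrite addrC addrAC addrC addrA addrAC.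
Qed.

Lemma mcoeff_mon2_large (f : {mpoly k[2]}) s i :
  (msize f <= s + i)%N -> f@_(mon2 s i) = 0.
Proof. by move=> le_f; apply/memN_msupp_eq0/msize_mdeg_ge; rewrite mdeg_mon2. Qed.

End Coefficients.

Theorem lemma3p1 (k : fieldType) (hk : [pchar k] =i pred0)
    (m1 m2 : nat) (hm1 : (0 < m1)%N) (hm2 : (0 < m2)%N)
    (hdvd : ~~ (m2 %| m1)%N)
    (f : {mpoly k[2]}) (g : {poly k})
    (hf : der m1 m2 f = inx g) :
  (exists c : k, f = c%:MP) /\ g = 0.
Proof.
(* The row [i], the power of [y], comes first here and second in [mon2]. *)
pose c i s := f@_(mon2 s i).
have rec i s := @der_eq_inx_rec k m1 m2 f g s i hf.
have c1 s : c 1 s = g`_s := der_eq_inx_coef0 s hm1 hm2 hf.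
have c_large i s : (msize f <= s + i)%N -> c i s = 0 := @mcoeff_mon2_large k f s i.
have [c1_0 c0_0] : (forall s, c 1 s = 0) /\ (forall s, (0 < s)%N -> c 0 s = 0).
  pose P s := (c 0 s != 0) || (c 1 s != 0).
  have P_bound s : P s -> (s <= msize f)%N.
    apply: contraLR; rewrite -ltnNge => /ltnW le_s.
    by rewrite /P !c_large ?eqxx ?addn0 // (leq_trans le_s) ?leq_addr.
  (* The bound by [msize f] makes the search for a nonzero coefficient in rows 0 and 1 finite, hence
     decidable. *)
  have [exP|nP] := boolP (has P (iota 0 (msize f).+1)); last first.
    have P0 s : P s = false.
      apply/negbTE/negP=> Ps; case/negP: nP; apply/hasP; exists s => //.
      by rewrite mem_iota /= ltnS P_bound.
    by split=> s => [|_]; apply/eqP/negPn; have := P0 s; rewrite /P => /norP[].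
  have {}exP : exists s, P s by have/hasP[s _ Ps] := exP; exists s.
  case: (ex_maxnP exP P_bound) => D PD maxD.
  have c01_0 s : (D < s)%N -> c 0 s = 0 /\ c 1 s = 0.
    rewrite ltnNge => /(contra (maxD s)) /norP[].
    by rewrite !negbK => /eqP-> /eqP->.
  have c0_0 s : (D < s)%N -> c 0 s = 0 by case/c01_0.
  have c1_0 s : (D < s)%N -> c 1 s = 0 by case/c01_0.
  have [c1D|c1D] := eqVneq (c 1 D) 0; last first.
    (* At [q = msize f] the monomial has larger total degree than [f] allows. *)
    have /eqP[] := coef_neq0_of_c1 hk hm2 rec c0_0 c1_0 (msize f) c1D.
    by apply: c_large; lia.
  have c0D : c 0 D != 0 by move: PD; rewrite /P c1D eqxx orbF.
  case: (posnP D) => [D0|D_gt0]; last first.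
    have /eqP[] := coef_neq0_of_c0 hk hm2 rec c0_0 c1_0 hdvd (msize f) D_gt0 c0D.
    by apply: c_large; lia.
  split=> s; last by rewrite -D0; apply: c0_0.
  by case: (posnP s) => [->|s_gt0]; [rewrite -{}D0 | apply: c1_0; rewrite D0].
split; last by apply/polyP=> s; rewrite coef0 -c1.
exists (c 0 0%N); apply/mpolyP=> m; rewrite (mon2_eta m) mcoeffC.
set s := m ord0; set i := m ord_max.
have [|] := boolP ((i != 0%N) || (s != 0%N)).
  move=> neq; rewrite (coef_constant hk hm2 rec c1_0 c0_0 neq).
  by rewrite -mdeg_eq0 mdeg_mon2 addn_eq0 andbC -[_ && _]negbK negb_and neq mulr0.
rewrite negb_or !negbK => /andP[/eqP-> /eqP->].
by rewrite -mdeg_eq0 mdeg_mon2 mulr1.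
Qed.
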